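(* Let $X=\{0\}\cup\{k^{-1}\colon k\in\mathbb N\}\subset\mathbb R$, where $\mathbb N=\{1,2,\dots\}$, with the metric $|x-y|$. Fix an integer $n\ge 2$. For $A\in X(n)$ let $\mathcal R(A)=A\setminus\{\min A\}$ if $|A|=n$ and $\mathcal R(A)=A$ if $|A|<n$. Then: (a) $\mathcal R$ is a Hölder continuous retraction of $X(n)$ onto $X(n-1)$, with Hölder exponent $1/2$; (b) $X$ does not have the Lipschitz Clustering Property.
   Context: For a metric space $(X,d)$ and a positive integer $n$, $X(n)=\{A\subset X\colon 1\le |A|\le n\}$, equipped with the Hausdorff metric $\Delta(A,B)=\max\left(\sup_{a\in A}\operatorname{dist}(a,B),\ \sup_{b\in B}\operatorname{dist}(b,A)\right)$; $X(n-1)\subset X(n)$. A retraction of $X(n)$ onto $X(n-1)$ is a map $X(n)\to X(n-1)$ whose restriction to $X(n-1)$ is the identity. A map $\mathcal R$ is Hölder continuous with exponent $1/2$ if there is a constant $C$ with $\Delta(\mathcal R(A),\mathcal R(B))\le C\,\Delta(A,B)^{1/2}$ for all $A,B$. $X$ has the Lipschitz Clustering Property (LCP) if for every integer $n\ge 2$ there exists a Lipschitz retraction from $X(n)$ onto $X(n-1)$. *)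

(* Defs.v *)
From HB Require Import structures.
From mathcomp Require Import all_boot all_order all_algebra.
From mathcomp Require Import all_classical all_reals all_analysis.
Import Order.TTheory GRing.Theory Num.Theory.
Import numFieldNormedType.Exports.

Set Implicit Arguments.
Unset Strict Implicit.
Unset Printing Implicit Defensive.

Local Open Scope classical_set_scope.
Local Open Scope card_scope.
Local Open Scope ring_scope.

(* A metric space (X, d) is given as a subset X of a metricType T, with the
   restricted distance; [set: T] gives T itself.  A map defined on X(n) is
   represented by a function on all of set T, and every property below looks
   only at its values on X(n). *)

Definition finite_subset_space (T : Type) (X : set T) (n : nat) : set (set T) :=
  [set A | A `<=` X /\ A !=set0 /\ A #<= `I_n].

(* sup and inf are real-valued: they are the intended (attained) extrema
   because the arguments are nonempty finite sets. *)

Definition point_set_dist (R : realType) (T : metricType R)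
    (a : T) (B : set T) : R :=
  inf [set mdist a b | b in B].

Definition hausdorff_dist (R : realType) (T : metricType R)
    (A B : set T) : R :=
  Num.max (sup [set point_set_dist a B | a in A])
          (sup [set point_set_dist b A | b in B]).

Definition is_retraction (S : Type) (D E : set S) (f : S -> S) : Prop :=
  (forall A, D A -> E (f A)) /\ (forall A, E A -> f A = A).

Definition hausdorff_lipschitz_on (R : realType) (T : metricType R)
    (D : set (set T)) (f : set T -> set T) : Prop :=
  exists C : R, forall A B, D A -> D B ->
    hausdorff_dist (f A) (f B) <= C * hausdorff_dist A B.

Definition hausdorff_holder_on (R : realType) (T : metricType R) (alpha : R)
    (D : set (set T)) (f : set T -> set T) : Prop :=
  exists C : R, forall A B, D A -> D B ->
    hausdorff_dist (f A) (f B) <= C * (hausdorff_dist A B) `^ alpha.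

Definition lipschitz_clustering (R : realType) (T : metricType R)
    (X : set T) : Prop :=
  forall n, (2 <= n)%N -> exists f : set T -> set T,
    is_retraction (finite_subset_space X n) (finite_subset_space X n.-1) f /\
    hausdorff_lipschitz_on (finite_subset_space X n) f.

(* The metricType structure with mdist x y = `|y - x| is carried by R^o. *)
Definition harmonic_set (R : realType) : set R^o :=
  [set x : R | x = 0 \/ exists k : nat, (0 < k)%N /\ x = k%:R^-1].
Arguments harmonic_set : clear implicits.

(* The default value 0 is irrelevant: it is only returned if A has no
   minimum. *)
Definition set_minimum (R : realType) (A : set R) : R :=
  xget 0 [set m | A m /\ lbound A m].

Definition drop_min (R : realType) (n : nat) (A : set R^o) : set R^o :=
  if `[< A #= `I_n >] then A `\ set_minimum A else A.
Arguments drop_min : clear implicits.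

(* Main.v *)
(** Distinct points [x], [y] of [X] satisfy [x ^ 2 <= 2 * |x - y|].  Hence, with
    [δ] the Hausdorff distance of [A] and [B], these sets have the same points
    above [sqrt (2 δ)], and dropping the minimum changes them only below that
    threshold, up to the coincidences handled by counting points.

    For the failure of the clustering property, suppose that [f] is a
    [K]-Lipschitz retraction of [X(4)] onto [X(3)], and put [c = 1/(p+1)],
    [d = 1/p] and [A_r = {0, 1/r, c, d}].  For [r] large, [A_r] is so close to
    [{0, c, d}] that [f A_r] contains [c] and [d].  Passing from [r + 1] to [r]
    moves [f A_r] by at most [K/(r(r+1))], which for [r >= 6 K p] is less than the
    gap of [X] at [c] and at [d], so [c] and [d] persist down to [r = 6 K p].
    There, [A_r] is within [d - c] of [{0, 1/r, c}], so for [p = 12 K^2] the set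
    [f A_r] also has distinct points near [0] and [1/r]: four points in all. *)

Require Import Defs.
From HB Require Import structures.
From mathcomp Require Import all_boot all_order all_algebra.
From mathcomp Require Import all_classical all_reals all_analysis.
From mathcomp Require Import ring lra zify.
Import Order.TTheory GRing.Theory Num.Theory.
Import numFieldNormedType.Exports.

Local Open Scope classical_set_scope.
Local Open Scope card_scope.
Local Open Scope ring_scope.

(** * Counting points of finite sets, and minimizers on them *)

Lemma card_eq_setU1 (T : Type) (A : set T) (n : nat) (x : T) :
  ~ A x -> A #= `I_n -> (x |` A) #= `I_n.+1.
Proof.
move=> Ax An; apply/eq_cardSP; exists x; first by left.
suff -> : (x |` A) `\ x = A by [].
apply/seteqP; split=> y /=; first by case=> -[].
by move=> Ay; split; [right|move=> yx; apply: Ax; rewrite -yx].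
Qed.

Lemma card_le_setU1 (T : Type) (A : set T) (n : nat) (x : T) :
  A #<= `I_n -> (x |` A) #<= `I_n.+1.
Proof.
move=> An; have [m Am] : exists m, A #= `I_m.
  by apply/finite_setP/finite_set_leP; exists n.
have mn : (m <= n)%N by rewrite -card_le_II -(card_le_eql Am).
have [Ax|Ax] := pselect (A x).
  rewrite (_ : x |` A = A); first by rewrite (card_le_eql Am) card_le_II leqW.
  by apply/seteqP; split=> y /=; [case=> [->|]|right].
by rewrite (card_le_eql (card_eq_setU1 _ _ _ _ Ax Am)) card_le_II.
Qed.

Lemma card_eq_setD1 (T : Type) (A : set T) (n : nat) (x : T) :
  A x -> A #= `I_n.+1 -> A `\ x #= `I_n.
Proof.
move=> Ax An; have /finite_setP[m Am] : finite_set (A `\ x).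
  by apply: finite_setD; apply/finite_setP; exists n.+1.
have : (x |` A `\ x) #= `I_m.+1 by apply: card_eq_setU1 Am => -[_]; apply.
by rewrite setD1K// (card_eql An) => /card_eq_II[->].
Qed.

(** A point of [A] outside [B] would give [n.+1] points inside [A]. This is the counting that
    settles the coincidences in [drop_min_near]. *)
Lemma subset_card_eq (T : Type) (A B : set T) (n : nat) :
  B `<=` A -> B #= `I_n -> A #<= `I_n -> A = B.
Proof.
move=> BA Bn An; apply/seteqP; split=> // x Ax; apply: contrapT => Bx.
have : (x |` B) #<= `I_n.
  by apply: card_le_trans An; apply: subset_card_le => y /= [->|/BA].
by rewrite (card_le_eql (card_eq_setU1 _ _ _ _ Bx Bn)) card_le_II ltnn.
Qed.

Lemma finite_arg_min (R : realType) (T : Type) (A : set T) (f : T -> R) :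
  finite_set A -> A !=set0 ->
  exists2 a, A a & forall b, A b -> f a <= f b.
Proof.
move=> /finite_setP[n An] A0.
elim: n A An A0 => [|n IH] A; first by rewrite II0 card_eq0 => /eqP-> [].
move=> /eq_cardSP[x Ax An] _.
have [A1|A1] := pselect ((A `\ x) !=set0); last first.
  exists x => // b Ab; have [->//|bx] := pselect (b = x).
  by case: A1; exists b.
have [a [Aa _] amin] := IH _ An A1.
case: (leP (f a) (f x)) => ax; [exists a => //|exists x => //] => b Ab;
  have [->//|bx] := pselect (b = x); first exact: amin.
by apply: le_trans (ltW ax) _; apply: amin.
Qed.

(** * The Hausdorff distance in terms of pairs of nearby points *)

Section hausdorff.
Context {R : realType} {T : metricType R}.
Implicit Types (A B : set T) (a : T).

Lemma hausdorff_distC A B : hausdorff_dist A B = hausdorff_dist B A.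
Proof. exact: maxC. Qed.

Lemma point_set_dist_le a b B : B b -> point_set_dist a B <= mdist a b.
Proof.
move=> Bb; apply: ge_inf; last by exists b.
by exists 0 => _ [c _ <-]; exact: mdist_ge0.
Qed.

Lemma point_set_dist_attained a B : finite_set B -> B !=set0 ->
  exists2 b, B b & mdist a b <= point_set_dist a B.
Proof.
move=> Bfin B0; have [b Bb bmin] := finite_arg_min R T B (mdist a) Bfin B0.
exists b => //; apply: lb_le_inf; first by exists (mdist a b), b.
by move=> _ [c Bc <-]; exact: bmin.
Qed.

Lemma hausdorff_dist_le A B e : A !=set0 -> B !=set0 ->
  (forall a, A a -> exists2 b, B b & mdist a b <= e) ->
  (forall b, B b -> exists2 a, A a & mdist b a <= e) ->
  hausdorff_dist A B <= e.
Proof.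
have dist_le C D : C !=set0 -> (forall a, C a -> exists2 b, D b & mdist a b <= e) ->
    sup [set point_set_dist a D | a in C] <= e.
  move=> [c Cc] CD; apply: sup_le_ub; first by exists (point_set_dist c D), c.
  move=> _ [a /CD[b Db ab] <-]; exact: le_trans (point_set_dist_le _ _ _ Db) ab.
by move=> A0 B0 AB BA; rewrite /hausdorff_dist ge_max !dist_le.
Qed.

Lemma hausdorff_dist_near A B a : finite_set A -> finite_set B -> B !=set0 ->
  A a -> exists2 b, B b & mdist a b <= hausdorff_dist A B.
Proof.
move=> Afin Bfin B0 Aa.
have [b Bb ab] := point_set_dist_attained a B Bfin B0; exists b => //.
apply: (le_trans ab); rewrite /hausdorff_dist le_max; apply/orP; left.
apply: ub_le_sup; last by exists a.
(* Minimizing the negated distance gives a maximum over [A], hence the upper bound without which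
   [sup] would be a default value. *)
have [c Ac cmax] := finite_arg_min R T A (fun x => - point_set_dist x B) Afin
  (ex_intro _ _ Aa).
by exists (point_set_dist c B) => _ [x Ax <-]; rewrite -lerN2 cmax.
Qed.

Lemma hausdorff_dist_ge0 A B : finite_set A -> finite_set B ->
  A !=set0 -> B !=set0 -> 0 <= hausdorff_dist A B.
Proof.
move=> Afin Bfin [a Aa] B0.
have [b _] := hausdorff_dist_near _ _ _ Afin Bfin B0 Aa.
by apply: le_trans; exact: mdist_ge0.
Qed.

End hausdorff.

(** * Gaps between the points of the harmonic set *)

Section harmonic.
Context {R : realType}.
Implicit Types (x y : R) (k : nat).

Lemma harmonic_set_ge0 x : harmonic_set R x -> 0 <= x.
Proof. by case=> [->//|[k [_ ->]]]; rewrite invr_ge0. Qed.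

Lemma harmonic_set_le1 x : harmonic_set R x -> x <= 1.
Proof. by case=> [->//|[k [k0 ->]]]; rewrite invf_le1 ?ler1n ?ltr0n. Qed.

Lemma harmonic_setV k : (0 < k)%N -> harmonic_set R k%:R^-1.
Proof. by move=> k0; right; exists k. Qed.

(** The nearest neighbour of [1/k] is [1/(k+1)]: the distance to [1/j] is [|j - k|/(jk)], and
    [j <= |j - k| (k+1)] for all [j <> k]. *)
Lemma harmonic_gap k x : (0 < k)%N -> harmonic_set R x ->
  `|k%:R^-1 - x| < (k * k.+1)%:R^-1 -> x = k%:R^-1.
Proof.
move=> k0 Hx; apply: contraPeq => xk; apply/negP; rewrite -leNgt.
have kR : 0 < k%:R :> R by rewrite ltr0n.
case: Hx xk => [->|[j [j0 ->]]] xk.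
  rewrite subr0 ger0_norm ?invr_ge0 ?ler0n// lef_pV2 ?posrE ?ltr0n ?muln_gt0 ?k0//.
  by rewrite ler_nat; apply: leq_pmulr.
have jR : 0 < j%:R :> R by rewrite ltr0n.
have jk : j <> k by move=> jk; rewrite jk eqxx in xk.
have -> : k%:R^-1 - j%:R^-1 = (j%:R - k%:R) / (j%:R * k%:R) :> R.
  by field; rewrite ?lt0r_neq0.
rewrite normrM (gtr0_norm (x := (_ * _)^-1)) ?invr_gt0 ?mulr_gt0//.
rewrite ler_pdivlMr ?mulr_gt0// mulrC -natrM ler_pdivrMr ?ltr0n ?muln_gt0 ?k0//.
have [kj|jk'] := leqP k j.
  by rewrite ger0_norm ?subr_ge0 ?ler_nat// -natrB// -natrM ler_nat; nia.
by rewrite ltr0_norm ?subr_lt0 ?ltr_nat// opprB -natrB 1?ltnW// -natrM ler_nat; nia.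
Qed.

Lemma harmonic_sqr_le x y : harmonic_set R x -> harmonic_set R y ->
  x != y -> x ^+ 2 <= 2 * `|x - y|.
Proof.
case=> [->|[k [k0 ->]]] Hy xy; first by rewrite expr0n mulr_ge0.
have : (k * k.+1)%:R^-1 <= `|k%:R^-1 - y|.
  by rewrite leNgt; apply: contraNN xy => /(harmonic_gap _ _ k0 Hy)->.
(* What remains is [1/k^2 <= 2/(k(k+1))], that is [k + 1 <= 2k]. *)
rewrite -(ler_pM2l (ltr0n _ 2)); apply: le_trans.
rewrite exprVn -natrX ler_pdivlMr ?ltr0n ?muln_gt0 ?k0// ler_pdivrMl ?ltr0n ?expn_gt0 ?k0//.
by rewrite -natrM ler_nat; nia.
Qed.

End harmonic.

(** * Dropping the minimum is a Hölder retraction *)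

Section drop_min.
Context {R : realType} (n : nat).
Implicit Types (A B : set R^o) (x y : R).

Let X : set (set R^o) := finite_subset_space (harmonic_set R) n.

Lemma set_minimumP A x : A x -> lbound A x -> set_minimum A = x.
Proof.
move=> Ax xlb.
have [Am mlb] : A (set_minimum A) /\ lbound A (set_minimum A).
  by apply: (xgetPex 0 (P := [set m | A m /\ lbound A m])); exists x.
by apply: le_anti; rewrite (mlb x Ax) (xlb _ Am).
Qed.

Lemma drop_minP A y : finite_set A ->
  drop_min R n A y <-> A y /\ ~ (A #= `I_n /\ lbound A y).
Proof.
move=> Afin; rewrite /drop_min; case: asboolP => An; last first.
  by split=> [Ay|[]//]; split=> // -[].
split=> -[Ay ny]; split=> //.
  by move=> [_ ylb]; apply: ny; rewrite /= (set_minimumP _ _ Ay ylb).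
have [m Am mlb] := finite_arg_min _ _ _ idfun Afin (ex_intro _ _ Ay).
by move=> /= ym; apply: ny; split=> //; rewrite ym (set_minimumP _ _ Am mlb).
Qed.

Lemma finite_subset_space_finite (T : Type) (Y : set T) (m : nat) (A : set T) :
  finite_subset_space Y m A -> finite_set A.
Proof. by case=> _ [_ Am]; apply/finite_set_leP; exists m. Qed.

Lemma drop_min_retraction : (2 <= n)%N ->
  is_retraction X (finite_subset_space (harmonic_set R) n.-1) (drop_min R n).
Proof.
case: n @X => // -[//|m] Y _; split=> A; last first.
  move=> [_ [_ Am]]; rewrite /drop_min; case: asboolP => // An.
  by move: Am; rewrite (card_le_eql An) card_le_II ltnn.
move=> YA; have Afin := finite_subset_space_finite _ _ _ _ YA.
case: YA => [AX [A0 An]]; rewrite /drop_min; case: asboolP => An'; last first.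
  split=> //; split=> //; have /finite_setP[k Ak] := Afin.
  move: An; rewrite !(card_le_eql Ak) !card_le_II leq_eqVlt => /predU1P[km|//].
  by case: An'; rewrite -km.
have [a Aa amin] := finite_arg_min _ _ _ idfun Afin A0.
rewrite (set_minimumP _ _ Aa amin).
have Aan := card_eq_setD1 _ _ _ _ Aa An'.
split; first by move=> x [/AX].
split; last by rewrite (card_le_eql Aan) card_le_II.
(* Here [2 <= n] enters: after the removal there are still [m.+1] points. *)
by move/eq_cardSP: Aan => [x Ax _]; exists x.
Qed.

(** Call a point large if its square exceeds [2 * d]; large points are common to [A] and [B]. The
    candidates for [y] are [x] itself if it is large, otherwise a point [z] of [B] near [x] or
    another small point of [B]. If all fail, [B] has [n] points, and counting determines [A] so
    precisely that [x] would have been dropped from it. *)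
Lemma drop_min_near A B (d x : R) : X A -> X B ->
  (forall a, A a -> exists2 b, B b & `|a - b| <= d) ->
  (forall b, B b -> exists2 a, A a & `|b - a| <= d) ->
  drop_min R n A x ->
  exists2 y, drop_min R n B y & `|x - y| ^+ 2 <= 2 * d.
Proof.
move=> XA XB AB BA.
have Afin := finite_subset_space_finite _ _ _ _ XA.
have Bfin := finite_subset_space_finite _ _ _ _ XB.
case: XA XB => [AX [_ An]] [BX [_ Bn]] RAx.
have [Ax Axmin] : A x /\ ~ (A #= `I_n /\ lbound A x) by apply/drop_minP.
have [z Bz xz] := AB x Ax; have d0 := le_trans (normr_ge0 _) xz.
have x0 := harmonic_set_ge0 _ (AX _ Ax).
(* Both points lie in [[0, 1]], so the square of their distance is at most the distance. *)
have near_small : `|x - z| ^+ 2 <= 2 * d.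
  have : `|x - z| <= 1.
    have := harmonic_set_ge0 _ (BX _ Bz); have := harmonic_set_le1 _ (BX _ Bz).
    by have := harmonic_set_le1 _ (AX _ Ax); rewrite ler_norml; lra.
  by have := normr_ge0 (x - z); nra.
have shared C D c : (forall a, C a -> exists2 b, D b & `|a - b| <= d) ->
    C `<=` harmonic_set R -> D `<=` harmonic_set R -> C c -> 2 * d < c ^+ 2 -> D c.
  move=> CD CX DX Cc dc; have [b Db cb] := CD c Cc.
  have [->//|bc] := eqVneq c b.
  by have := harmonic_sqr_le _ _ (CX _ Cc) (DX _ Db) bc; lra.
have [xbig|xsmall] := ltP (2 * d) (x ^+ 2).
  have Bx := shared A B x AB AX BX Ax xbig.
  have [RBx|] := pselect (drop_min R n B x).
    by exists x => //; rewrite subrr normr0 expr0n mulr_ge0.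
  move=> /drop_minP-/(_ Bfin) nRBx; have [Bn' Bmin] : B #= `I_n /\ lbound B x.
    by apply: contrapT => ?; apply: nRBx.
  (* The minimum [x] of [B] is large, so all of [B] is large and lies in [A]. *)
  suff ABE : A = B by case: Axmin; rewrite ABE.
  apply: subset_card_eq Bn' An => b Bb; apply: (shared B A) => //.
  by apply: (lt_le_trans xbig); rewrite ler_sqr ?nnegrE ?(le_trans x0)// Bmin.
have [RBz|] := pselect (drop_min R n B z); first by exists z.
move=> /drop_minP-/(_ Bfin) nRBz; have [Bn' Bmin] : B #= `I_n /\ lbound B z.
  by apply: contrapT => ?; apply: nRBz.
apply: contrapT => noy; case: Axmin.
(* A small [b] other than the minimum [z] survives in [B], and two nonnegative numbers differ by at
   most the larger one, so [b] would serve as [y]. *)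
have Bbig b : (B `\ z) b -> 2 * d < b ^+ 2.
  move=> [Bb bz]; rewrite ltNge; apply/negP => bsmall; apply: noy; exists b.
    apply/drop_minP => //; split=> // -[_ bmin]; apply: bz => /=.
    by apply: le_anti; rewrite bmin// Bmin.
  have b0 : 0 <= (b : R) := harmonic_set_ge0 _ (BX _ Bb).
  rewrite real_normK ?num_real// (sqrrB x (b : R)).
  have xb : 0 <= x * b by rewrite mulr_ge0.
  have [bx|/ltW bx] := leP (b : R) x.
    have : b * b <= x * b by rewrite ler_wpM2r.
    by lra.
  have : x * x <= x * b by rewrite ler_wpM2l.
  by lra.
case: n Bn' An Bn {noy nRBz} @X => [|m] Bm Am _ _.
  by move: Bm; rewrite II0 card_eq0 => /eqP B0; rewrite B0 in Bz.
(* Replacing [z] by the small point [x] keeps the count [n]; the other points are large, hence in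
   [A], and [x] is below them. *)
have Cm : (x |` (B `\ z)) #= `I_m.+1.
  apply: card_eq_setU1; last exact: card_eq_setD1.
  by move/Bbig; rewrite ltNge xsmall.
have AE : A = x |` (B `\ z).
  apply: subset_card_eq Cm Am => y /= [->//|Bzy].
  by apply: (shared B A) => //; [exact: Bzy.1|exact: Bbig].
rewrite AE; split=> // y /= [->//|/[dup] -[By _] /Bbig ybig].
have y0 := harmonic_set_ge0 _ (BX _ By).
by rewrite -(@ler_sqr _ x y)// ltW// (le_lt_trans xsmall).
Qed.

Lemma drop_min_holder : (2 <= n)%N ->
  hausdorff_holder_on 2^-1 X (drop_min R n).
Proof.
move=> n2; exists (Num.sqrt 2) => A B XA XB.
have [XR _] := drop_min_retraction n2.
have [_ [RA0 _]] := XR _ XA; have [_ [RB0 _]] := XR _ XB.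
have Afin := finite_subset_space_finite _ _ _ _ XA.
have Bfin := finite_subset_space_finite _ _ _ _ XB.
have [_ [A0 _]] := XA; have [_ [B0 _]] := XB.
have H0 := hausdorff_dist_ge0 _ _ Afin Bfin A0 B0.
rewrite powR12_sqrt// -sqrtrM//.
have near C D : X C -> X D -> hausdorff_dist C D = hausdorff_dist A B ->
    forall a, C a -> exists2 b, D b & `|a - b| <= hausdorff_dist A B.
  move=> XC XD <- a Ca.
  have Cfin := finite_subset_space_finite _ _ _ _ XC.
  have Dfin := finite_subset_space_finite _ _ _ _ XD.
  have [b Db] := hausdorff_dist_near _ _ _ Cfin Dfin XD.2.1 Ca.
  by exists b => //; rewrite distrC.
have nearAB := near _ _ XA XB erefl.
have nearBA := near _ _ XB XA (hausdorff_distC _ _).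
have sqrt_le (x y : R^o) : `|x - y| ^+ 2 <= 2 * hausdorff_dist A B ->
    mdist x y <= Num.sqrt (2 * hausdorff_dist A B).
  move=> xy; rewrite [mdist _ _]distrC -[leLHS]normr_id -sqrtr_sqr.
  exact: ler_wsqrtr.
apply: hausdorff_dist_le => // a Ra.
  have [b Rb /sqrt_le ab] := drop_min_near _ _ _ _ XA XB nearAB nearBA Ra.
  by exists b.
have [b Rb /sqrt_le ab] := drop_min_near _ _ _ _ XB XA nearBA nearAB Ra.
by exists b.
Qed.

End drop_min.

(** * No Lipschitz retraction from four points to three *)

Section no_lipschitz_clustering.
Context {R : realType}.

Let X (m : nat) : set (set R^o) := finite_subset_space (harmonic_set R) m.

Let V (k : nat) : R^o := k%:R^-1.

Let V_gt0 k : (0 < k)%N -> 0 < (V k : R).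
Proof. by move=> k0; rewrite invr_gt0 ltr0n. Qed.

Let V_le j k : (0 < j)%N -> (j <= k)%N -> (V k : R) <= V j.
Proof. by move=> j0 jk; rewrite lef_pV2 ?posrE ?ltr0n ?ler_nat//; lia. Qed.

Let V_sub k : (0 < k)%N -> (V k : R) - V k.+1 = (k * k.+1)%:R^-1.
Proof.
by move=> k0; rewrite /V natrM -natr1; field; rewrite natr1 !pnatr_eq0; lia.
Qed.

Let X4 (a b c d : R^o) : harmonic_set R a -> harmonic_set R b ->
  harmonic_set R c -> harmonic_set R d -> X 4 (a |` (b |` (c |` [set d]))).
Proof.
move=> Ha Hb Hc Hd; split; first by move=> x /= [->|[->|[->|->]]].
split; first by exists a; left.
by do 3 apply: card_le_setU1; rewrite (card_le_eql card_set1) card_lexx.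
Qed.

Lemma harmonic_not_lipschitz_clustering :
  ~ lipschitz_clustering (harmonic_set R).
Proof.
move=> /(_ 4 isT)[f [[fX fid] [C fC]]].
(* A natural Lipschitz constant reduces the later estimates to inequalities between natural
   numbers. *)
have [K [K0 CK]] : exists K : nat, (0 < K)%N /\ C <= K%:R.
  exists (Num.truncn `|C|).+1; split=> //.
  by rewrite (le_trans (ler_norm C))// ltW// truncnS_gt.
have fK A B : X 4 A -> X 4 B -> hausdorff_dist (f A) (f B) <= K%:R * hausdorff_dist A B.
  move=> XA XB; apply: (le_trans (fC _ _ XA XB)); apply: ler_wpM2r => //.
  by apply: hausdorff_dist_ge0 (finite_subset_space_finite _ _ _ _ XA)
    (finite_subset_space_finite _ _ _ _ XB) XA.2.1 XB.2.1.
have f_near A B e x : X 4 A -> X 4 B -> hausdorff_dist A B <= e -> f A x ->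
    exists2 y, f B y & `|x - y| <= K%:R * e.
  move=> XA XB ABe fx; have XfA := fX _ XA; have XfB := fX _ XB.
  have [y fy xy] := hausdorff_dist_near _ _ _ (finite_subset_space_finite _ _ _ _ XfA)
    (finite_subset_space_finite _ _ _ _ XfB) XfB.2.1 fx.
  exists y => //; rewrite distrC; apply: (le_trans xy); apply: (le_trans (fK _ _ XA XB)).
  exact: ler_wpM2l.
(* With [r = M * p], the choice of [p] turns [2K/(p(p+1)) < 1/r] into [p < p + 1]. The factor 6 in
   [M] comes from [(p+1)(p+2) <= 6p^2]. *)
pose p := (12 * K * K)%N; pose M := (6 * K)%N.
have p0 : (0 < p)%N by rewrite /p; nia.
pose c := V p.+1; pose d := V p.
pose A r : set R^o := 0 |` (V r |` (c |` [set d])).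
have H0 : harmonic_set R 0 by left.
have Hc : harmonic_set R c by exact: harmonic_setV.
have Hd : harmonic_set R d by exact: harmonic_setV.
have XA r : (0 < r)%N -> X 4 (A r) by move=> r0; apply: X4 => //; exact: harmonic_setV.
have card3 (x y z : R^o) : x |` (y |` [set z]) #<= `I_3.
  by do 2 apply: card_le_setU1; rewrite (card_le_eql card_set1) card_lexx.
have X3 (x y z : R^o) : harmonic_set R x -> harmonic_set R y -> harmonic_set R z ->
    X 3 (x |` (y |` [set z])).
  move=> Hx Hy Hz; split; first by move=> w /= [->|[->|->]].
  by split; [exists x; left|exact: card3].
have X34 B : X 3 B -> X 4 B.
  by move=> [BX [B0 B3]]; split=> //; split=> //; rewrite (card_le_trans B3)// card_le_II.
pose B := 0 |` (c |` [set d]).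
have fB : f B = B by apply: fid; exact: X3.
have XB : X 4 B by apply: X34; exact: X3.
have AB r : (0 < r)%N -> hausdorff_dist B (A r) <= V r.
  move=> r0; have Vr := ltW (V_gt0 _ r0).
  apply: hausdorff_dist_le; [by exists 0; left|by exists 0; left| |].
    move=> x Bx; exists x; rewrite ?mdistxx//.
    by case: Bx => [|[]]; [left|right; right; left|right; right; right].
  move=> x [->|[->|xB]].
  - by exists 0; rewrite ?mdistxx//; left.
  - by exists 0; [left|rewrite /mdist/= sub0r normrN ger0_norm].
  - by exists x; rewrite ?mdistxx//; right.
have AS r : (0 < r)%N -> hausdorff_dist (A r.+1) (A r) <= (r * r.+1)%:R^-1.
  move=> r0; have e0 : 0 <= (r * r.+1)%:R^-1 :> R by rewrite invr_ge0.
  have Vr : `|(V r : R) - V r.+1| <= (r * r.+1)%:R^-1.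
    by rewrite V_sub// ger0_norm.
  apply: hausdorff_dist_le; [by exists 0; left|by exists 0; left| |].
    move=> x [->|[->|xB]].
    - by exists 0; rewrite ?mdistxx//; left.
    - by exists (V r) => //; right; left.
    - by exists x; rewrite ?mdistxx//; right; right.
  move=> x [->|[->|xB]].
  - by exists 0; rewrite ?mdistxx//; left.
  - by exists (V r.+1); [right; left|rewrite [mdist _ _]distrC].
  - by exists x; rewrite ?mdistxx//; right; right.
(* This is the gap of the set at [c]; the one at [d] is larger, so one bound serves both. *)
pose gap : R := (p.+1 * p.+2)%:R^-1.
have stay D E k e : (p <= k <= p.+1)%N -> X 4 D -> X 4 E ->
    hausdorff_dist D E <= e -> K%:R * e < gap -> f D (V k) -> f E (V k).
  move=> kp XD XE DE eg fk; have [y fy ky] := f_near _ _ _ _ XD XE DE fk.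
  suff <- : y = V k by [].
  apply: harmonic_gap; [by lia|exact: (fX _ XE).1|].
  apply: (le_lt_trans ky); apply: (lt_le_trans eg).
  by rewrite lef_pV2 ?posrE ?ltr0n ?ler_nat; nia.
have Kgap m : (K * (p.+1 * p.+2) < m)%N -> K%:R * m%:R^-1 < gap.
  move=> Km; rewrite ltr_pdivrMr ?ltr0n; last by lia.
  by rewrite mulrC ltr_pdivlMr ?ltr0n// -natrM ltr_nat.
have cd_in k : (p <= k <= p.+1)%N -> f (A (M * p)) (V k).
  (* [N] is so large that already [K/N < gap], which starts the descent from [f B = B]; the
     induction then lowers the index to [M * p]. *)
  move=> kp; pose N := (K * (p.+1 * p.+2)).+1.
  have fN : f (A (M * p + N)%N) (V k).
    have r0 : (0 < M * p + N)%N by lia.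
    apply: stay (AB _ r0) _ _ => //; [exact: XA|apply: Kgap; lia|].
    rewrite fB; have : k = p \/ k = p.+1 by lia.
    by case=> ->; right; [right|left].
  elim: N fN => [|N IH]; first by rewrite addn0.
  rewrite addnS => fN; apply: IH.
  have r0 : (0 < M * p + N)%N by rewrite /M; nia.
  apply: stay (AS _ r0) _ fN => //; [exact: XA|exact: XA|].
  by apply: Kgap; rewrite /M; nia.
have r0 : (0 < M * p)%N by rewrite /M; nia.
pose r := (M * p)%N; pose D : set R^o := 0 |` (V r |` [set c]).
have Hr : harmonic_set R (V r) by exact: harmonic_setV.
have XD : X 3 D by exact: X3.
pose e : R := (p * p.+1)%:R^-1.
have DA : hausdorff_dist D (A r) <= e.
  have e0 : 0 <= e by rewrite invr_ge0.
  apply: hausdorff_dist_le; [by exists 0; left|by exists 0; left| |].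
    move=> x Dx; exists x; rewrite ?mdistxx//.
    by case: Dx => [|[]]; [left|right; left|right; right; left].
  move=> x [->|[->|[->|->]]].
  - by exists 0; rewrite ?mdistxx//; left.
  - by exists (V r); rewrite ?mdistxx//; right; left.
  - by exists c; rewrite ?mdistxx//; right; right.
  - by exists c; [right; right|rewrite [mdist _ _]distrC V_sub// ger0_norm].
have fD : f D = D by exact: fid.
have near_in x : D x -> exists2 y, f (A r) y & `|x - y| <= K%:R * e.
  by move=> Dx; apply: (f_near D) => //; [exact: X34|exact: XA|rewrite fD].
have [y0 fy0 y0e] := near_in 0 (or_introl erefl).
have [y1 fy1 y1e] := near_in (V r) (or_intror (or_introl erefl)).
have fc : f (A r) c by apply: cd_in; rewrite leqnSn leqnn.
have fd : f (A r) d by apply: cd_in; rewrite leqnSn leqnn.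
(* The points near 0 and near [V r] are separated since [K * e] is below half of [V r]; with [rc]
   this gives [y0 < y1 < c < d]. *)
have Ke : 2 * (K%:R * e) < V r.
  have e0 : 0 < (p * p.+1)%:R :> R by rewrite ltr0n muln_gt0 p0.
  rewrite mulrA -natrM (ltr_pdivrMr _ _ e0) mulrC; have := r0.
  rewrite -(ltr0n R) => rR; rewrite (ltr_pdivlMr _ _ rR).
  by rewrite -natrM ltr_nat /M /p; nia.
have rc : 2 * (V r : R) <= c.
  by rewrite /c /V ler_pdivrMr ?ltr0n// ler_pdivlMl ?ltr0n// -natrM ler_nat /r /M; nia.
have cd : (c : R) < d by rewrite ltf_pV2 ?posrE ?ltr0n ?ltr_nat.
have Vr0 := V_gt0 _ r0.
move: y0e y1e; rewrite !ler_distl => /andP[y0r _] /andP[ry1 y1r].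
have y01 : (y0 : R) < y1 by lra.
have y1c : (y1 : R) < c by lra.
have E1 : [set d] #= `I_1 by exact: card_set1.
have E2 : (c |` [set d]) #= `I_2.
  by apply: card_eq_setU1 E1 => /= cdE; move: cd; rewrite cdE ltxx.
have E3 : (y1 |` (c |` [set d])) #= `I_3.
  by apply: card_eq_setU1 E2 => /= -[] y1E; move: y1E y1c cd => ->; lra.
have E4 : (y0 |` (y1 |` (c |` [set d]))) #= `I_4.
  by apply: card_eq_setU1 E3 => /= -[|[]] y0E; move: y0E y01 y1c cd => ->; lra.
have [_ [_ fA3]] := fX _ (XA _ r0).
have : (y0 |` (y1 |` (c |` [set d]))) #<= `I_3.
  apply: card_le_trans fA3; apply: subset_card_le => y /=.
  by case=> [->|[->|[->|->]]].
by rewrite (card_le_eql E4) card_le_II.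
Qed.

End no_lipschitz_clustering.

Theorem proposition4p6 (R : realType) (n : nat) (hn : (2 <= n)%N) :
  (is_retraction (finite_subset_space (harmonic_set R) n)
      (finite_subset_space (harmonic_set R) n.-1) (drop_min R n) /\
   hausdorff_holder_on 2^-1
      (finite_subset_space (harmonic_set R) n) (drop_min R n)) /\
  ~ lipschitz_clustering (harmonic_set R).
Proof.
split; last exact: harmonic_not_lipschitz_clustering.
by split; [exact: drop_min_retraction|exact: drop_min_holder].
Qed.
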